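(* Let $M$ be the adjacency matrix of a strongly regular graph $G$ with parameters $(n,k,\lambda,\mu)$. If there exists a fixed point free Seidel automorphism of $G$ with permutation matrix $P$, then $P(M+I)$ is the adjacency matrix of a Deza graph with valency $k+1$, with parameters $\{a,b\}=\{\lambda+2,\mu\}$, and with strongly regular children whose adjacency matrices are $M$ and $J-I-M$.
   Context: A strongly regular graph with parameters $(n,k,\lambda,\mu)$ is a $k$-regular graph on $n$ vertices in which any two distinct adjacent vertices have exactly $\lambda$ common neighbours and any two distinct non-adjacent vertices have exactly $\mu$ common neighbours. A Deza graph with parameters $(n,k,b,a)$, $b\ge a$, is a $k$-regular connected graph on $n$ vertices such that any two distinct vertices have either $b$ or $a$ common neighbours; equivalently its adjacency matrix $N$ satisfies $N^2=aA+bB+kI$ for symmetric $(0,1)$-matrices $A,B$ with $A+B+I=J$ ($J$ the all-ones matrix); the graphs with adjacency matrices $A$ and $B$ are its children. A Seidel automorphism of a graph is an involutive automorphism $\varphi$ ($\varphi^2=\mathrm{id}$, $\varphi\ne\mathrm{id}$) such that for every vertex $v$ with $\varphi(v)\neq v$, $v$ and $\varphi(v)$ are non-adjacent; fixed point free means $\varphi(v)\ne v$ for all $v$. Its permutation matrix $P$ has $P_{u,v}=1$ iff $v=\varphi(u)$.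
   Formalization: Connectedness of the Deza graph is claimed only if G is connected or n = 2(k+1); otherwise it fails (e.g. G = 4K_2 with its copies swapped in pairs gives two disjoint K_{2,2}). All other claims are unconditional. *)

(* Defs.v *)
From HB Require Import structures.
From mathcomp Require Import all_boot all_order all_algebra all_fingroup.

Set Implicit Arguments.
Unset Strict Implicit.
Unset Printing Implicit Defensive.

Local Open Scope ring_scope.

Record sgraph (n : nat) := SGraph {
  adj :> rel 'I_n;
  adj_sym : symmetric adj;
  adj_irr : irreflexive adj }.

Section Graphs.
Variable n : nat.
Implicit Types (G H : sgraph n) (phi : {perm 'I_n}).

Definition neigh G (v : 'I_n) : {set 'I_n} := [set w | G v w].

Definition common_neigh G (u v : 'I_n) : {set 'I_n} := neigh G u :&: neigh G v.

Definition regular G (k : nat) := forall v, #|neigh G v| = k.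

Definition gconnected G := forall u v, connect G u v.

Definition adjmx G : 'M[int]_n := \matrix_(u, v) (G u v)%:R.

(* Empty and complete graphs are allowed: lambda is arbitrary for the former,
   mu for the latter. *)
Definition strongly_regular G (k lambda mu : nat) :=
  [/\ regular G k,
      forall u v, u != v -> G u v -> #|common_neigh G u v| = lambda
    & forall u v, u != v -> ~~ G u v -> #|common_neigh G u v| = mu].

Definition is_strongly_regular G :=
  exists k lambda mu, strongly_regular G k lambda mu.

(* The requirements on a Deza graph except connectedness, which P (M + I) may
   lack: for four disjoint copies of K_2 (k = 1, lambda = mu = 0) and an
   involution swapping them in pairs, it is the adjacency matrix of two disjoint
   copies of K_{2,2}. *)
Definition deza_counts G (k b a : nat) :=
  [/\ (a <= b)%N, regular G k
    & forall u v, u != v ->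
        #|common_neigh G u v| = b \/ #|common_neigh G u v| = a].

Definition deza G (k b a : nat) := deza_counts G k b a /\ gconnected G.

(* HA and HB are the children of G: with A, B their adjacency matrices,
   A + B + I = J and N^2 = a A + b B + k I. For a = b this does not determine
   A and B. *)
Definition deza_children G (k b a : nat) (HA HB : sgraph n) :=
  adjmx HA + adjmx HB + 1%:M = const_mx 1 /\
  adjmx G *m adjmx G = a%:R *: adjmx HA + b%:R *: adjmx HB + k%:R%:M.

Definition automorphism G phi := forall u v, G (phi u) (phi v) = G u v.

Definition seidel_automorphism G phi :=
  [/\ automorphism G phi, forall v, phi (phi v) = v, phi <> 1%g
    & forall v, phi v != v -> ~~ G v (phi v)].

Definition fixed_point_free phi := forall v, phi v != v.

End Graphs.

(* Main.v *)
Require Import Defs.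
From HB Require Import structures.
From mathcomp Require Import all_boot all_order all_algebra all_fingroup.

(** Write [N[u]] for the closed neighbourhood of [u] in [G].  In the graph [H]
    of [P (M + I)] the neighbourhood of [u] is [N[phi u]], so counting common
    neighbours in [H] amounts to counting [N[u] :&: N[v]] in [G], which has
    [lambda + 2] elements when [u] and [v] are adjacent and [mu] otherwise.
    For connectedness, [u - phi u - w] is a path of [H] whenever [u w] is an
    edge of [G], so components of [G] lie inside components of [H]; and if
    [n = 2 (k + 1)] and [N[u]], [N[v]] are disjoint, they cover all vertices,
    hence [phi u], which is not in [N[u]], is in [N[v]]. *)

Import GRing.Theory.

Set Implicit Arguments.
Unset Strict Implicit.
Unset Printing Implicit Defensive.

Local Open Scope ring_scope.

Section GraphTheory.
Variable n : nat.
Implicit Types (G H : sgraph n) (phi : {perm 'I_n}).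

Definition closed_neigh G (v : 'I_n) : {set 'I_n} := v |: neigh G v.

Lemma in_closed_neigh G u v : (v \in closed_neigh G u) = (v == u) || G u v.
Proof. by rewrite !inE. Qed.

Lemma card_closed_neigh G k v : regular G k -> #|closed_neigh G v| = k.+1.
Proof. by move=> Gk; rewrite cardsU1 Gk inE adj_irr. Qed.

(** If [u] and [v] are adjacent, both lie in both closed neighbourhoods, which adds two vertices to
    their [lambda] common neighbours. If not, neither lies in the other's closed neighbourhood, and
    only common neighbours remain. *)
Lemma card_closed_neighI G k lambda mu u v :
  strongly_regular G k lambda mu -> u != v ->
  #|closed_neigh G u :&: closed_neigh G v|
    = if G u v then (lambda + 2)%N else mu.
Proof.
case=> _ Gl Gm uv; case: ifPn => Guv.
  rewrite -(Gl _ _ uv Guv).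
  have -> : closed_neigh G u :&: closed_neigh G v
            = u |: (v |: common_neigh G u v).
    apply/setP=> w; rewrite !inE.
    case: (eqVneq w u) => [->|wu] /=; first by rewrite adj_sym Guv orbT.
    by case: (eqVneq w v) => [->|wv] /=; rewrite ?Guv.
  by rewrite !cardsU1 !inE !adj_irr negb_or uv !andbF addn2.
rewrite -(Gm _ _ uv Guv); congr #|pred_of_set _|.
apply/setP=> w; rewrite !inE.
case: (eqVneq w u) => [->|wu] /=.
  by rewrite (negbTE uv) adj_irr adj_sym (negbTE Guv).
by case: (eqVneq w v) => [->|wv] //=; rewrite adj_irr (negbTE Guv).
Qed.

Lemma adjmx_sqrE G u v : (adjmx G *m adjmx G) u v = #|common_neigh G u v|%:R.
Proof.
rewrite mxE -sum1_card natr_sum [RHS]big_mkcond /=; apply: eq_bigr => w _.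
by rewrite !mxE !inE (adj_sym G w v); do 2!case: (G _ _).
Qed.

Definition compl_rel G : rel 'I_n := fun u v => (u != v) && ~~ G u v.

Lemma compl_rel_sym G : symmetric (compl_rel G).
Proof. by move=> u v; rewrite /compl_rel eq_sym adj_sym. Qed.

Lemma compl_rel_irr G : irreflexive (compl_rel G).
Proof. by move=> u; rewrite /compl_rel eqxx. Qed.

Definition compl_graph G := SGraph (@compl_rel_sym G) (@compl_rel_irr G).

Lemma neigh_compl G u : neigh (compl_graph G) u = ~: closed_neigh G u.
Proof. by apply/setP=> w; rewrite !inE /= /compl_rel negb_or eq_sym. Qed.

Lemma adjmx_compl G : adjmx (compl_graph G) = const_mx 1 - 1%:M - adjmx G.
Proof.
apply/matrixP=> u v; rewrite !mxE /= /compl_rel.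
by case: (eqVneq u v) => [->|_] /=; rewrite ?adj_irr; case: (G _ _).
Qed.

Lemma adjmx_compl_sum G :
  adjmx G + adjmx (compl_graph G) + 1%:M = const_mx 1.
Proof. by rewrite [adjmx G + _]addrC adjmx_compl !subrK. Qed.

(** Neighbourhoods in the complement are complements of closed neighbourhoods, so
    inclusion-exclusion reduces the count to [card_closed_neighI]. *)
Lemma strongly_regular_compl G k lambda mu :
  strongly_regular G k lambda mu -> is_strongly_regular (compl_graph G).
Proof.
move=> srG; have [Gk _ _] := srG.
have card_common u v : u != v -> #|common_neigh (compl_graph G) u v|
    = (n - (k.+1 + k.+1 - if G u v then (lambda + 2) else mu))%N.
  move=> uv; rewrite /common_neigh !neigh_compl -setCU cardsCs setCK card_ord.
  by rewrite cardsU !(card_closed_neigh _ Gk) (card_closed_neighI srG uv).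
(* Complementation exchanges the two kinds of pairs: the new [lambda] comes from [mu], and the new
   [mu] from [lambda + 2]. *)
exists (n - k.+1)%N, (n - (k.+1 + k.+1 - mu))%N.
exists (n - (k.+1 + k.+1 - (lambda + 2)))%N; split=> [v|u v uv|u v uv].
- by rewrite neigh_compl cardsCs setCK card_ord (card_closed_neigh _ Gk).
- by rewrite /= /compl_rel uv => /negbTE Guv; rewrite card_common // Guv.
- by rewrite /= /compl_rel uv negbK => Guv; rewrite card_common // Guv.
Qed.

Section Twist.
Variables (G : sgraph n) (phi : {perm 'I_n}).
Hypotheses (seidel_phi : seidel_automorphism G phi)
           (fpf_phi : fixed_point_free phi).

Let phiK u : phi (phi u) = u.
Proof. by case: seidel_phi. Qed.

Let phi_aut : automorphism G phi.
Proof. by case: seidel_phi. Qed.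

Let nadj_phi u : G u (phi u) = false.
Proof. by case: seidel_phi => _ _ _ nG; apply/negbTE/nG/fpf_phi. Qed.

Definition twist_rel : rel 'I_n := fun u v => v \in closed_neigh G (phi u).

(** Applying the involutive automorphism [phi] to both vertices turns [v] in [N[phi u]] into [phi v]
    in [N[u]], which is a symmetric relation between [u] and [phi v]. *)
Lemma twist_rel_sym : symmetric twist_rel.
Proof.
move=> u v; rewrite /twist_rel !in_closed_neigh.
by rewrite -{1}(phiK v) (inj_eq perm_inj) eq_sym -phi_aut phiK adj_sym.
Qed.

Lemma twist_rel_irr : irreflexive twist_rel.
Proof.
move=> u; rewrite /twist_rel in_closed_neigh adj_sym nadj_phi orbF eq_sym.
exact/negbTE/fpf_phi.
Qed.

Definition twist_graph := SGraph twist_rel_sym twist_rel_irr.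

Lemma neigh_twist u : neigh twist_graph u = closed_neigh G (phi u).
Proof. by apply/setP=> w; rewrite inE. Qed.

(** Multiplying by [perm_mx phi] on the left puts row [phi u] in place of row [u]; since [G] has no
    loops, the entries of [M + I] are 0 or 1. *)
Lemma adjmx_twist : adjmx twist_graph = perm_mx phi *m (adjmx G + 1%:M).
Proof.
rewrite -row_permE; apply/matrixP=> u v.
rewrite !mxE /= /twist_rel in_closed_neigh eq_sym.
by case: eqVneq => [->|_]; rewrite ?adj_irr ?add0r ?addr0.
Qed.

Lemma regular_twist k : regular G k -> regular twist_graph k.+1.
Proof. by move=> Gk v; rewrite neigh_twist (card_closed_neigh _ Gk). Qed.

(** The count concerns the pair [phi u], [phi v], but [phi] preserves adjacency, so it is decided by
    [G u v]. This is why the children are [G] and its complement themselves. *)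
Lemma card_common_neigh_twist k lambda mu u v :
  strongly_regular G k lambda mu -> u != v ->
  #|common_neigh twist_graph u v| = if G u v then (lambda + 2)%N else mu.
Proof.
move=> srG uv; rewrite /common_neigh !neigh_twist.
by rewrite (card_closed_neighI srG) ?phi_aut // (inj_eq perm_inj).
Qed.

Lemma adjmx_twist_sqr k lambda mu :
  strongly_regular G k lambda mu ->
  adjmx twist_graph *m adjmx twist_graph =
    (lambda + 2)%:R *: adjmx G + mu%:R *: adjmx (compl_graph G) + k.+1%:R%:M.
Proof.
move=> srG; have [Gk _ _] := srG.
apply/matrixP=> u v; rewrite adjmx_sqrE !mxE /= /compl_rel.
have [<-|uv] := eqVneq u v.
  by rewrite /common_neigh setIid (regular_twist Gk) adj_irr !mulr0 !add0r.
rewrite (card_common_neigh_twist srG uv).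
by case: (G u v); rewrite /= !(mulr0, mulr1, addr0, add0r).
Qed.

Lemma connect_twist_phi u : connect twist_graph u (phi u).
Proof. by apply: connect1; rewrite /= /twist_rel in_closed_neigh eqxx. Qed.

Lemma connect_twist_closed_neigh u v :
  v \in closed_neigh G u -> connect twist_graph u v.
Proof.
move=> uv; apply: connect_trans (connect_twist_phi u) (connect1 _).
by rewrite /= /twist_rel phiK.
Qed.

Lemma gconnected_twist : gconnected G -> gconnected twist_graph.
Proof.
move=> cG u v; move: (cG u v); apply: connect_sub => {}u {}v Guv.
by apply: connect_twist_closed_neigh; rewrite in_closed_neigh Guv orbT.
Qed.

Lemma gconnected_twist_card k :
  regular G k -> n = (2 * k.+1)%N -> gconnected twist_graph.
Proof.
move=> Gk nE u v.
have csym : connect_sym twist_graph := sym_connect_sym (@adj_sym _ twist_graph).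
(* A vertex [w] in both closed neighbourhoods is joined to [u] and to [v] in the twisted graph. *)
have [disj|[w]] := set_0Vmem (closed_neigh G u :&: closed_neigh G v); last first.
  rewrite inE => /andP[uw vw].
  apply: connect_trans (connect_twist_closed_neigh uw) _.
  by rewrite csym; apply: connect_twist_closed_neigh.
have cover : closed_neigh G u :|: closed_neigh G v = setT.
  apply/eqP; rewrite eqEcard subsetT cardsT card_ord cardsU disj cards0 subn0.
  by rewrite !(card_closed_neigh _ Gk) addnn -mul2n -nE leqnn.
have : phi u \in closed_neigh G u :|: closed_neigh G v by rewrite cover inE.
rewrite inE in_closed_neigh (negbTE (fpf_phi u)) nadj_phi /= => vphi.
apply: connect_trans (connect_twist_phi u) _.
by rewrite csym; apply: connect_twist_closed_neigh.
Qed.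

End Twist.
End GraphTheory.

Unset Implicit Arguments.

Theorem theorem9 (n k lambda mu : nat) (G : sgraph n)
    (hG : strongly_regular G k lambda mu)
    (phi : {perm 'I_n})
    (hphi : seidel_automorphism G phi)
    (hfpf : fixed_point_free phi) :
  exists (H HA HB : sgraph n) (a b : nat),
    adjmx H = perm_mx phi *m (adjmx G + 1%:M)
    /\ deza_counts H k.+1 b a
    /\ (gconnected G \/ n = (2 * k.+1)%N -> deza H k.+1 b a)
    /\ deza_children H k.+1 b a HA HB
    /\ is_strongly_regular HA
    /\ is_strongly_regular HB
    /\ ([/\ a = (lambda + 2)%N, b = mu,
            adjmx HA = adjmx G & adjmx HB = const_mx 1 - 1%:M - adjmx G]
        \/ [/\ a = mu, b = (lambda + 2)%N,
               adjmx HA = const_mx 1 - 1%:M - adjmx G & adjmx HB = adjmx G]).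
Proof.
have [Gk _ _] := hG; have isrG : is_strongly_regular G by exists k, lambda, mu.
have isrC := strongly_regular_compl hG; have adjC := adjmx_compl G.
pose H := twist_graph hphi hfpf; have sqrH := adjmx_twist_sqr hphi hfpf hG.
have connH : gconnected G \/ n = (2 * k.+1)%N -> gconnected H.
  by case=> [/gconnected_twist|/(gconnected_twist_card _ _ Gk)]; apply.
have cardH u v (uv : u != v) := card_common_neigh_twist hphi hfpf hG uv.
(* The convention [a <= b] decides which of [lambda + 2] and [mu] is called [a], and with it the
   order of the two children. *)
have [le_ab|/ltnW le_ab] := leqP (lambda + 2) mu.
- have dH : deza_counts H k.+1 mu (lambda + 2).
    split=> // [|u v /cardH ->]; first exact: regular_twist.
    by case: ifP; [right | left].
  exists H, G, (compl_graph G), (lambda + 2)%N, mu.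
  do !split=> //; [exact: adjmx_twist | exact: connH | | by left].
  exact: adjmx_compl_sum.
- have dH : deza_counts H k.+1 (lambda + 2) mu.
    split=> // [|u v /cardH ->]; first exact: regular_twist.
    by case: ifP; [left | right].
  exists H, (compl_graph G), G, mu, (lambda + 2)%N.
  do !split=> //; [exact: adjmx_twist | exact: connH | | | by right].
    by rewrite [adjmx _ + _]addrC adjmx_compl_sum.
  by rewrite [_ *: _ + _ *: _]addrC.
Qed.
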